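(* Let $Q\subset\mathbb{R}^d$ be a compact convex polyhedron, and let $f:Q\to\mathbb{R}$ be a continuous convex function with $\|f\|_{\mathrm{Lip}}=L<\infty$. Let $(r_n)_{n\ge1}$ be a bounded sequence of positive numbers and $(\delta_n)_{n\ge1}$ a sequence of positive numbers with $\delta_n=o(r_n)$ as $n\to\infty$. For each $n$ let $f_n$ be an estimator of $f$ (a random real-valued function on $Q$), let $\mathcal{M}_n\subset Q$ be a finite set such that any $x\in Q$ is a convex combination of points of $\mathcal{M}_n$ whose distance to $x$ is not more than $\delta_n$, and let $f^c_n$ be the convex estimator associated with $f_n$ and $\mathcal{M}_n$. For a sequence $(R_n)_n$ of nonnegative random variables, consider the following types of convergence: (T-1) for every $\varepsilon>0$ there exists $M>0$ such that $\sup_n\mathbb{P}(R_n>Mr_n)<\varepsilon$; (T-2) $\lim_{n\to\infty}\mathbb{P}(R_n>\varepsilon r_n)=0$ for every $\varepsilon>0$; (T-3, $O$ version) $R_n=O(r_n)$ almost surely; (T-3, $o$ version) $R_n=o(r_n)$ almost surely; (T-4) for every $\varepsilon>0$, $\sum_{n=1}^\infty\mathbb{P}(R_n>\varepsilon r_n)<\infty$. If any one of these types of convergence holds for $R_n=\|f_n-f\|_\infty$, then the same type of convergence also holds for $R_n=\|f^c_n-f\|_\infty$.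
   Context: $|x-y|$ denotes the Euclidean distance in $\mathbb{R}^d$, $\|f\|_{\mathrm{Lip}}=\sup\{|f(x)-f(y)|/|x-y| : x,y\in Q,\ x\neq y\}$, and $\|g\|_\infty=\sup_{x\in Q}|g(x)|$. $\mathbb{P}$ is the underlying probability measure; the quantities $\|f_n-f\|_\infty$ and $\|f^c_n-f\|_\infty$ are understood to be nonnegative random variables, while $r_n$, $\delta_n$, $\mathcal{M}_n$ are nonrandom. $Q$ is a (nonempty) bounded closed convex polyhedron, i.e. the convex hull of its finite set of vertices. $\mathscr{C}$ denotes the set of finite real-valued convex functions defined on $Q$. For $f_n:Q\to\mathbb{R}$ and a finite set $\mathcal{M}_n\subset Q$ whose convex hull is $Q$ (which is automatic under the condition on $\mathcal{M}_n$ in the claim), put $$\mathscr{L}_n=\{\psi\in\mathscr{C} : \psi(x)\le f_n(x)\text{ for all }x\in\mathcal{M}_n\}.$$ The convex estimator associated with $f_n$ and $\mathcal{M}_n$ is the pointwise supremum $f^c_n=\sup\{\psi : \psi\in\mathscr{L}_n\}$ on $Q$ (for each realization of $f_n$). ''$R_n=O(r_n)$ almost surely'' means that with probability one $\sup_n R_n/r_n<\infty$ (the bound may depend on the outcome); ''$R_n=o(r_n)$ almost surely'' means that with probability one $R_n/r_n\to0$. *)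

(* Defs.v *)
From HB Require Import structures.
From mathcomp Require Import all_boot all_order all_algebra.
From mathcomp Require Import all_classical all_reals all_analysis.
From mathcomp Require Import measurable_realfun.
Set Implicit Arguments.
Unset Strict Implicit.
Unset Printing Implicit Defensive.
Import Order.TTheory GRing.Theory Num.Theory.
Import numFieldNormedType.Exports.

Local Open Scope classical_set_scope.
Local Open Scope ring_scope.

(* The norm that the library puts on ['rV[R]_d] is the maximum norm, so the
   Euclidean distance is defined here; both induce the same topology. *)
Definition eucl_dist (R : realType) (d : nat) (x y : 'rV[R]_d) : R :=
  Num.sqrt (\sum_(i < d) (x 0 i - y 0 i) ^+ 2).

Definition conv_hull (R : realType) (d : nat) (A : set 'rV[R]_d) :
    set 'rV[R]_d :=
  [set x | exists (k : nat) (p : 'I_k -> 'rV[R]_d) (t : 'I_k -> R),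
     [/\ forall i, A (p i), forall i, 0 <= t i, \sum_(i < k) t i = 1
       & x = \sum_(i < k) t i *: p i]].

Definition vertices (R : realType) (d : nat) (A : set 'rV[R]_d) :
    set 'rV[R]_d :=
  [set x | A x /\ forall (y z : 'rV[R]_d) (t : R), A y -> A z ->
     0 < t < 1 -> x = t *: y + (1 - t) *: z -> y = x /\ z = x].

Definition compact_polyhedron (R : realType) (d : nat) (Q : set 'rV[R]_d) :=
  finite_set (vertices Q) /\ Q = conv_hull (vertices Q).

(* A function on [Q] is represented by a total function of which only the
   values on [Q] are ever used. *)

Definition sup_norm (R : realType) (d : nat) (Q : set 'rV[R]_d)
    (g : 'rV[R]_d -> R) : \bar R :=
  ereal_sup [set (`|g x|)%:E | x in Q].

(* The maximum with 0 only matters when [Q] is a singleton: the supremum is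
   then over the empty set, for which [ereal_sup] returns -oo. *)
Definition lip_norm (R : realType) (d : nat) (Q : set 'rV[R]_d)
    (g : 'rV[R]_d -> R) : \bar R :=
  maxe 0%E (ereal_sup
    [set e | exists x y : 'rV[R]_d,
       [/\ Q x, Q y, x <> y & e = (`|g x - g y| / eucl_dist x y)%:E]]).

Definition convex_minorants (R : realType) (d : nat)
    (Q M : set 'rV[R]_d) (g : 'rV[R]_d -> R) : set ('rV[R]_d -> R) :=
  [set psi | convex_function Q psi /\ forall x, M x -> psi x <= g x].

(* When [M] is a finite subset of [Q] whose convex hull is [Q], for each [x]
   in [Q] this is the supremum of a nonempty set of reals that is bounded
   above, so that the default value of [sup] is not reached. *)
Definition convex_estimator (R : realType) (d : nat)
    (Q M : set 'rV[R]_d) (g : 'rV[R]_d -> R) : 'rV[R]_d -> R :=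
  fun x => sup [set psi x | psi in convex_minorants Q M g].

(* Random variables below take values in [\bar R], as the uniform norm of an
   arbitrary real function may be infinite. *)

Definition conv_T1 (R : realType) (disp : measure_display)
    (Omega : measurableType disp) (P : probability Omega R)
    (r : nat -> R) (X : nat -> Omega -> \bar R) :=
  forall eps : R, 0 < eps -> exists2 M : R, 0 < M &
    (ereal_sup (range (fun n => P [set w | (M * r n)%:E < X n w])) < eps%:E)%E.

Definition conv_T2 (R : realType) (disp : measure_display)
    (Omega : measurableType disp) (P : probability Omega R)
    (r : nat -> R) (X : nat -> Omega -> \bar R) :=
  forall eps : R, 0 < eps ->
    P [set w | ((eps * r n)%:E < X n w)%E] @[n --> \oo] --> (0%R)%:E.

Definition conv_T3O (R : realType) (disp : measure_display)
    (Omega : measurableType disp) (P : probability Omega R)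
    (r : nat -> R) (X : nat -> Omega -> \bar R) :=
  {ae P, forall w,
    (ereal_sup (range (fun n => X n w * ((r n)^-1)%:E)) < +oo)%E}.

Definition conv_T3o (R : realType) (disp : measure_display)
    (Omega : measurableType disp) (P : probability Omega R)
    (r : nat -> R) (X : nat -> Omega -> \bar R) :=
  {ae P, forall w,
    (X n w * ((r n)^-1)%:E)%E @[n --> \oo] --> (0%R)%:E}.

Definition conv_T4 (R : realType) (disp : measure_display)
    (Omega : measurableType disp) (P : probability Omega R)
    (r : nat -> R) (X : nat -> Omega -> \bar R) :=
  forall eps : R, 0 < eps ->
    (\sum_(0 <= n <oo) P [set w | (eps * r n)%:E < X n w] < +oo)%E.

(* Main.v *)
Require Import Defs.
From HB Require Import structures.
From mathcomp Require Import all_boot all_order all_algebra.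
From mathcomp Require Import all_classical all_reals all_analysis.
From mathcomp Require Import measurable_realfun.
From mathcomp Require Import ring lra.
Set Implicit Arguments.
Unset Strict Implicit.
Unset Printing Implicit Defensive.
Import Order.TTheory GRing.Theory Num.Theory.
Import numFieldNormedType.Exports.

(** The whole probabilistic statement rests on one deterministic inequality:
    for every realization,
      ||f^c_n - f|| <= ||f_n - f|| + L delta_n      (uniform norms on Q).
    Write e for ||f_n - f||, assumed finite.  From below, f - e is convex and
    lies under f_n on M_n, so it competes in the supremum that defines f^c_n
    ([shifted_minorant]).  From above, write x in Q as a convex combination of
    points of M_n at distance at most delta_n; Jensen's inequality for a
    competitor psi bounds psi x by an average of values f_n p <= f p + e, and
    each f p is at most f x + L delta_n ([minorant_le]).  Together these give
    [sup_norm_convex_estimator].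

    What remains is that each of the five modes of convergence at rate r is
    stable under adding a nonrandom error c_n = o(r_n): such an error moves the
    threshold in an event of the form Y_n > b r_n only slightly
    ([exceedance_le]), and the normalized variable Y_n / r_n by a bounded null
    sequence ([ratio_le]). *)

Local Open Scope classical_set_scope.
Local Open Scope ring_scope.

(** * Convex combinations and Jensen's inequality *)

Lemma convex_function_comb (R : realType) (d : nat) (Q : set 'rV[R]_d)
    (g : 'rV[R]_d -> R) (x y : 'rV[R]_d) (s : R) :
  convex_function Q g -> 0 <= s -> s <= 1 -> Q x -> Q y ->
  g (s *: x + (1 - s) *: y) <= s * g x + (1 - s) * g y.
Proof.
move=> cg s0 s1 Qx Qy.
exact: (cg (Itv01 s0 s1) x y (mem_set Qx) (mem_set Qy)).
Qed.

Lemma conv_hull_convex (R : realType) (d : nat) (A : set 'rV[R]_d)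
    (x y : 'rV[R]_d) (s : R) :
  0 <= s -> s <= 1 -> conv_hull A x -> conv_hull A y ->
  conv_hull A (s *: x + (1 - s) *: y).
Proof.
move=> s0 s1 [k [p [t [pA t0 t1 ->]]]] [l [q [u [qA u0 u1 ->]]]].
exists (k + l)%N.
exists (fun i => match fintype.split i with inl j => p j | inr j => q j end).
exists (fun i => match fintype.split i with
  inl j => s * t j | inr j => (1 - s) * u j end).
have splitl (j : 'I_k) : fintype.split (lshift l j) = inl j := unsplitK (inl j).
have splitr (j : 'I_l) : fintype.split (rshift k j) = inr j := unsplitK (inr j).
split.
- by move=> i; case: (fintype.split i).
- by move=> i; case: (fintype.split i) => j; rewrite mulr_ge0 ?subr_ge0.
- rewrite big_split_ord/=.
  under eq_bigr do rewrite splitl.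
  under [X in _ + X]eq_bigr do rewrite splitr.
  by rewrite -!mulr_sumr t1 u1 !mulr1 subrKC.
- rewrite big_split_ord/= !scaler_sumr; congr (_ + _); apply: eq_bigr => i _.
  + by rewrite splitl scalerA.
  + by rewrite splitr scalerA.
Qed.

(** The induction splits off the first point and rescales the others by the
    remaining weight [1 - t ord0].  Membership of the combination in [Q] is
    proved along with the inequality, because convexity of [g] on [Q] may only
    be applied to points of [Q]. *)
Lemma jensen (R : realType) (d : nat) (Q : set 'rV[R]_d)
    (g : 'rV[R]_d -> R) :
  (forall x y s, 0 <= s -> s <= 1 -> Q x -> Q y ->
    Q (s *: x + (1 - s) *: y)) ->
  convex_function Q g ->
  forall (k : nat) (p : 'I_k -> 'rV[R]_d) (t : 'I_k -> R),
    (forall i, Q (p i)) -> (forall i, 0 <= t i) -> \sum_(i < k) t i = 1 ->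
    Q (\sum_(i < k) t i *: p i) /\
    g (\sum_(i < k) t i *: p i) <= \sum_(i < k) t i * g (p i).
Proof.
move=> cQ cg; elim=> [|k IH] p t Qp t0 t1.
  by move: t1; rewrite big_ord0 => /esym/eqP; rewrite oner_eq0.
rewrite !big_ord_recl in t1 *.
have tail_ge0 : 0 <= \sum_(i < k) t (lift ord0 i) by exact: sumr_ge0.
have s0 := t0 ord0.
have tailE : \sum_(i < k) t (lift ord0 i) = 1 - t ord0.
  by rewrite -t1 addrAC subrr add0r.
have s1 : t ord0 <= 1 by rewrite -subr_ge0 -tailE.
(* When the first weight is 1 the others vanish and cannot be rescaled. *)
have [tail0|tailN0] := eqVneq (1 - t ord0) 0.
  have tz i : t (lift ord0 i) = 0.
    move: tailE; rewrite tail0 => /eqP; rewrite psumr_eq0 => [|j _]; last first.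
      exact: t0.
    by move=> /allP/(_ i)/(_ (mem_index_enum i))/eqP.
  have -> : t ord0 = 1 by move/eqP: tail0; rewrite subr_eq0 => /eqP.
  rewrite scale1r mul1r !big1 => [|i _|i _]; rewrite ?tz ?mul0r ?scale0r//.
  by rewrite !addr0; split.
have tail_gt0 : 0 < 1 - t ord0 by rewrite lt_neqAle eq_sym tailN0 subr_ge0.
have [|||Qq gq] := IH (fun i => p (lift ord0 i))
    (fun i => t (lift ord0 i) / (1 - t ord0)).
- by move=> i; exact: Qp.
- by move=> i; rewrite divr_ge0// ltW.
- by rewrite -mulr_suml tailE divff.
set q := \sum_(i < k) _ in Qq gq.
have -> : \sum_(i < k) t (lift ord0 i) *: p (lift ord0 i) = (1 - t ord0) *: q.
  rewrite scaler_sumr; apply: eq_bigr => i _.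
  by rewrite scalerA mulrCA divff// mulr1.
have -> : \sum_(i < k) t (lift ord0 i) * g (p (lift ord0 i)) =
    (1 - t ord0) *
    \sum_(i < k) t (lift ord0 i) / (1 - t ord0) * g (p (lift ord0 i)).
  rewrite mulr_sumr; apply: eq_bigr => i _.
  by rewrite mulrA mulrCA divff// mulr1.
split; first exact: cQ.
apply: le_trans (convex_function_comb cg s0 s1 (Qp _) Qq) _.
by rewrite lerD2l ler_pM2l.
Qed.

(** * Comparison of the two uniform errors *)

Lemma eucl_dist_gt0 (R : realType) (d : nat) (x y : 'rV[R]_d) :
  x <> y -> 0 < eucl_dist x y.
Proof.
move=> xy; rewrite sqrtr_gt0 lt_neqAle sumr_ge0 ?andbT => [|i _]; last first.
  exact: sqr_ge0.
apply/eqP => /esym/eqP; rewrite psumr_eq0 => [/allP s0|i _]; last first.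
  exact: sqr_ge0.
apply: xy; apply/rowP => i; apply/eqP.
by have := s0 i (mem_index_enum i); rewrite /= sqrf_eq0 subr_eq0.
Qed.

Lemma lip_norm_ge0 (R : realType) (d : nat) (Q : set 'rV[R]_d)
    (f : 'rV[R]_d -> R) (L : R) : lip_norm Q f = L%:E -> 0 <= L.
Proof. by move=> fL; rewrite -lee_fin -fL le_max lexx. Qed.

Lemma lip_normP (R : realType) (d : nat) (Q : set 'rV[R]_d)
    (f : 'rV[R]_d -> R) (L : R) (x y : 'rV[R]_d) :
  lip_norm Q f = L%:E -> Q x -> Q y -> `|f x - f y| <= L * eucl_dist x y.
Proof.
move=> fL Qx Qy.
have [->|/eqP xy] := eqVneq x y.
  by rewrite subrr normr0 mulr_ge0 ?sqrtr_ge0// (lip_norm_ge0 fL).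
rewrite -ler_pdivrMr ?eucl_dist_gt0// -lee_fin -fL le_max.
by apply/orP; right; apply: ereal_sup_ubound; exists x, y.
Qed.

Lemma sup_norm_ge0 (R : realType) (d : nat) (Q : set 'rV[R]_d)
    (g : 'rV[R]_d -> R) : Q !=set0 -> (0 <= sup_norm Q g)%E.
Proof.
move=> [x Qx]; apply: (@le_trans _ _ (`|g x|)%:E); first by rewrite lee_fin.
by apply: ereal_sup_ubound; exists x.
Qed.

Section estimator_bounds.
Context (R : realType) (d : nat) (Q M : set 'rV[R]_d) (f g : 'rV[R]_d -> R).
Context (e : R).
Hypothesis Q_convex : forall x y s, 0 <= s -> s <= 1 -> Q x -> Q y ->
  Q (s *: x + (1 - s) *: y).
Hypothesis f_convex : convex_function Q f.
Hypothesis MQ : M `<=` Q.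
Hypothesis g_close : forall x, M x -> `|g x - f x| <= e.

Lemma shifted_minorant : convex_minorants Q M g (fun x => f x - e).
Proof.
have shiftE (s a b : R) :
  s * (a - e) + (1 - s) * (b - e) = s * a + (1 - s) * b - e by ring.
split.
  move=> t x y xQ yQ; apply: le_trans (lerB (f_convex t xQ yQ) (lexx e)) _.
  by rewrite convRE /unstable.onem -shiftE.
by move=> x Mx; have := g_close Mx; rewrite ler_distl => /andP[].
Qed.

(** Only the values of [psi] on [M] are controlled; Jensen's inequality carries
    that control to [x], and since the points of [M] used are near [x], going
    from [f] at these points to [f x] costs only [L * delta]. *)
Lemma minorant_le (L delta : R) (psi : 'rV[R]_d -> R) (x : 'rV[R]_d) :
  lip_norm Q f = L%:E -> Q x ->
  conv_hull (M `&` [set y | eucl_dist y x <= delta]) x ->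
  convex_minorants Q M g psi -> psi x <= f x + (e + L * delta).
Proof.
move=> fL Qx [k [p [t [pM t0 t1 xE]]]] [cpsi psig].
have Qp i : Q (p i) by apply: MQ; have [] := pM i.
have [_] := jensen Q_convex cpsi Qp t0 t1; rewrite -xE => /le_trans; apply.
rewrite -[leRHS]mul1r -t1 mulr_suml; apply: ler_sum => i _.
apply: ler_wpM2l => //; have [Mp /= pd] := pM i.
have := g_close Mp; rewrite ler_distl => /andP[_ gp].
have := lip_normP fL (Qp i) Qx; rewrite ler_distl => /andP[_ fp].
have := ler_wpM2l (lip_norm_ge0 fL) pd.
have := psig _ Mp; lra.
Qed.

End estimator_bounds.

(** When [g - f] is unbounded on [Q] the right-hand side is infinite.
    Otherwise the pointwise supremum is squeezed by [shifted_minorant] and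
    [minorant_le]; the former also makes the set of competing values nonempty
    and the latter bounds it, so that its [sup] is a genuine supremum. *)
Lemma sup_norm_convex_estimator (R : realType) (d : nat) (Q M : set 'rV[R]_d)
    (f g : 'rV[R]_d -> R) (L delta : R) :
  (forall x y s, 0 <= s -> s <= 1 -> Q x -> Q y ->
    Q (s *: x + (1 - s) *: y)) ->
  Q !=set0 -> convex_function Q f -> lip_norm Q f = L%:E -> 0 <= delta ->
  M `<=` Q ->
  (forall x, Q x -> conv_hull (M `&` [set y | eucl_dist y x <= delta]) x) ->
  (sup_norm Q (fun x => convex_estimator Q M g x - f x)%R <=
   sup_norm Q (fun x => g x - f x)%R + (L * delta)%:E)%E.
Proof.
move=> cQ Q0 cf fL delta0 MQ dM.
have := sup_norm_ge0 (fun x => g x - f x) Q0.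
case E : (sup_norm _ _) => [e| |] // _; last by rewrite addye// leey.
have g_close x : Q x -> `|g x - f x| <= e.
  by move=> Qx; rewrite -lee_fin -E; apply: ereal_sup_ubound; exists x.
have gM x : M x -> `|g x - f x| <= e by move/MQ; exact: g_close.
apply: ge_ereal_sup => _ [x Qx <-].
rewrite -EFinD lee_fin.
have Ld : 0 <= L * delta by rewrite mulr_ge0// (lip_norm_ge0 fL).
have ub : ubound [set psi x | psi in convex_minorants Q M g]
    (f x + (e + L * delta)).
  by move=> _ [psi mpsi <-]; exact: (minorant_le cQ MQ gM fL Qx (dM _ Qx)).
have low : [set psi x | psi in convex_minorants Q M g] (f x - e).
  by exists (fun y => f y - e) => //; exact: shifted_minorant.
have lo : f x - e <= convex_estimator Q M g x.
  apply: (sup_upper_bound _ low); split; first by exists (f x - e).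
  by exists (f x + (e + L * delta)).
have up : convex_estimator Q M g x <= f x + (e + L * delta).
  by apply: ge_sup => //; exists (f x - e).
by rewrite ler_distl; apply/andP; split; lra.
Qed.

(** * Stability of the modes of convergence under a negligible error *)

Section perturbation.
Context (R : realType) (disp : measure_display) (Omega : measurableType disp).
Context (P : probability Omega R) (r c : nat -> R).
Context (X Y : nat -> Omega -> \bar R).
Hypothesis r_gt0 : forall n, 0 < r n.
Hypothesis c_ge0 : forall n, 0 <= c n.
Hypothesis c_small : forall eps : R, 0 < eps ->
  \forall n \near \oo, c n <= eps * r n.
Hypothesis X_ge0 : forall n w, (0 <= X n w)%E.
Hypothesis Y_ge0 : forall n w, (0 <= Y n w)%E.
Hypothesis YX : forall n w, (Y n w <= X n w + (c n)%:E)%E.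
Hypothesis mX : forall n, measurable_fun setT (X n).
Hypothesis mY : forall n, measurable_fun setT (Y n).

(** A constant valid for every [n], not only eventually, is needed for the two
    modes that take a supremum over all [n]: [c n <= r n] holds eventually, and
    the finitely many other ratios are absorbed by their sum. *)
Lemma error_rate_bounded : exists2 C : R, 0 <= C & forall n, c n <= C * r n.
Proof.
have [N _ cN] := c_small ltr01.
have cr0 k : 0 <= c k / r k by rewrite divr_ge0// ltW.
have S0 : 0 <= \sum_(k < N) c k / r k by exact: sumr_ge0.
exists (1 + \sum_(k < N) c k / r k); first exact: addr_ge0.
move=> n; rewrite -ler_pdivrMr//; have [nN|Nn] := ltnP n N.
  rewrite (bigD1 (Ordinal nN))//= addrCA lerDl addr_ge0//.
  exact: sumr_ge0.
apply: (@le_trans _ _ 1); last by rewrite lerDl.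
by rewrite ler_pdivrMr//; exact: cN.
Qed.

Lemma exceedance_measurable (Z : Omega -> \bar R) (s : \bar R) :
  measurable_fun setT Z -> measurable [set w | (s < Z w)%E].
Proof.
by move=> mZ; rewrite -[X in measurable X]setTI; exact: emeasurable_fun_o_infty.
Qed.

(** If [c n] fits in the gap between the two thresholds, [Y n > b * r n] forces
    [X n > a * r n]; each mode below that is stated with probabilities uses
    this for a suitable pair [(a, b)]. *)
Lemma exceedance_le (n : nat) (a b : R) : c n <= (b - a) * r n ->
  (P [set w | ((b * r n)%:E < Y n w)%E] <=
   P [set w | ((a * r n)%:E < X n w)%E])%E.
Proof.
move=> cn.
apply: le_measure; rewrite ?inE; [exact: exceedance_measurable..|].
move=> w /= bY; have := lt_le_trans bY (YX n w).
case: (X n w) (X_ge0 n w) => [u| |]// _; last by move=> _; rewrite ltry.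
rewrite -EFinD !lte_fin; move: cn; rewrite mulrBl; lra.
Qed.

Lemma ratio_le (n : nat) (w : Omega) :
  (Y n w * ((r n)^-1)%:E <= X n w * ((r n)^-1)%:E + (c n / r n)%:E)%E.
Proof.
rewrite EFinM -ge0_muleDl ?lee_fin//.
by apply: lee_wpmul2r; rewrite ?lee_fin ?invr_ge0 ?(ltW (r_gt0 n)).
Qed.

Lemma conv_T1_perturb : conv_T1 P r X -> conv_T1 P r Y.
Proof.
have [C C0 cC] := error_rate_bounded.
move=> XT eps /XT[K K0 XK]; exists (K + C); first exact: ltr_wpDr.
apply: le_lt_trans XK; apply: ge_ereal_sup => _ [n _ <-].
apply: (@le_trans _ _ (P [set w | ((K * r n)%:E < X n w)%E])).
  by apply: exceedance_le; rewrite addrAC subrr add0r.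
by apply: ereal_sup_ubound; exists n.
Qed.

Lemma half_exceedance_le (eps : R) : 0 < eps -> \forall n \near \oo,
  (P [set w | ((eps * r n)%:E < Y n w)%E] <=
   P [set w | ((eps / 2 * r n)%:E < X n w)%E])%E.
Proof.
move=> e0; have := c_small (divr_gt0 e0 (ltr0Sn R 1)); apply: filterS => n cn.
by apply: exceedance_le; apply: le_trans cn _; rewrite ler_pM2r//; lra.
Qed.

Lemma conv_T2_perturb : conv_T2 P r X -> conv_T2 P r Y.
Proof.
move=> XT eps e0.
apply: (squeeze_cvge _ (cvg_cst _) (XT _ (divr_gt0 e0 (ltr0Sn R 1)))).
by apply: filterS (half_exceedance_le e0) => n ->; rewrite measure_ge0.
Qed.

Lemma conv_T3O_perturb : conv_T3O P r X -> conv_T3O P r Y.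
Proof.
have [C C0 cC] := error_rate_bounded.
apply: filterS => w Xw.
apply: (@le_lt_trans _ _
  (ereal_sup (range (fun n => (X n w * ((r n)^-1)%:E)%E)) + C%:E)%E).
  apply: ge_ereal_sup => _ [n _ <-].
  apply: (le_trans (ratio_le n w)); apply: leeD.
    by apply: ereal_sup_ubound; exists n.
  by rewrite lee_fin ler_pdivrMr.
exact: lte_add_pinfty Xw (ltry _).
Qed.

Lemma cvg_error_ratio : ((c n / r n)%:E @[n --> \oo] --> (0%R)%:E)%E.
Proof.
apply: cvg_EFin; first by near=> n.
apply/cvgrPdist_le => e e0; apply: filterS (c_small e0) => n cn.
rewrite /= sub0r normrN ger0_norm ?divr_ge0 ?(ltW (r_gt0 n))//.
by rewrite ler_pdivrMr.
Unshelve. all: by end_near. Qed.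

Lemma conv_T3o_perturb : conv_T3o P r X -> conv_T3o P r Y.
Proof.
apply: filterS => w Xw.
have XcD : ((X n w * ((r n)^-1)%:E + (c n / r n)%:E)%E @[n --> \oo] -->
    (0%R)%:E)%E.
  by rewrite -[(0%R)%:E]adde0; apply: cvgeD => //; exact: cvg_error_ratio.
apply: (squeeze_cvge _ (cvg_cst _) XcD).
near=> n; rewrite ratio_le andbT mule_ge0// lee_fin invr_ge0.
exact: ltW.
Unshelve. all: by end_near. Qed.

(** The comparison with [X] holds only from some [N] on, so both series are
    split at [N]; the head of the series of [Y] is a finite sum of
    probabilities. *)
Lemma conv_T4_perturb : conv_T4 P r X -> conv_T4 P r Y.
Proof.
move=> XT eps e0; have [N _ YN] := half_exceedance_le e0.
have := XT _ (divr_gt0 e0 (ltr0Sn R 1)).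
rewrite (nneseries_split 0 N) => [|k _]; last exact: measure_ge0.
rewrite [in X in _ -> X](nneseries_split 0 N) => [|k _]; last first.
  exact: measure_ge0.
rewrite add0n => Xlt; apply: lte_add_pinfty.
  apply: lte_sum_pinfty => k _.
  rewrite (le_lt_trans (probability_le1 _ _)) ?ltry//.
  exact: exceedance_measurable.
apply: (le_lt_trans _ (le_lt_trans (leeDr _ _) Xlt)); last first.
  by apply: sume_ge0 => k _; exact: measure_ge0.
rewrite eseries_cond [leRHS]eseries_cond.
apply: lee_nneseries => [k _ _|k]; first exact: measure_ge0.
by rewrite andTb => /YN.
Qed.

End perturbation.

Theorem theorem2 (R : realType) (d : nat)
  (disp : measure_display) (Omega : measurableType disp)
  (P : probability Omega R)
  (Q : set 'rV[R]_d) (f : 'rV[R]_d -> R) (L : R)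
  (r delta : nat -> R)
  (fn : nat -> Omega -> 'rV[R]_d -> R)
  (M : nat -> set 'rV[R]_d)
  (Q_nonempty : Q !=set0)
  (Q_polyhedron : compact_polyhedron Q)
  (f_continuous : {within Q, continuous f})
  (f_convex : convex_function Q f)
  (f_lip : lip_norm Q f = L%:E)
  (r_gt0 : forall n, 0 < r n)
  (r_bounded : bounded_fun r)
  (delta_gt0 : forall n, 0 < delta n)
  (delta_o_r : delta =o_\oo r)
  (fn_random : forall n x, Q x -> measurable_fun setT (fun w => fn n w x))
  (M_finite : forall n, finite_set (M n))
  (M_sub : forall n, M n `<=` Q)
  (M_dense : forall n x, Q x ->
     conv_hull (M n `&` [set y | eucl_dist y x <= delta n]) x) :
  let fcn n w := convex_estimator Q (M n) (fn n w) in
  let err n w : \bar R := sup_norm Q (fun x => fn n w x - f x) in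
  let errc n w : \bar R := sup_norm Q (fun x => fcn n w x - f x) in
  (forall n, measurable_fun setT (err n)) ->
  (forall n, measurable_fun setT (errc n)) ->
  [/\ conv_T1 P r err -> conv_T1 P r errc,
      conv_T2 P r err -> conv_T2 P r errc,
      conv_T3O P r err -> conv_T3O P r errc,
      conv_T3o P r err -> conv_T3o P r errc
    & conv_T4 P r err -> conv_T4 P r errc].
Proof.
move=> fcn err errc merr merrc.
have [_ QE] := Q_polyhedron.
have Q_convex x y s : 0 <= s -> s <= 1 -> Q x -> Q y ->
    Q (s *: x + (1 - s) *: y).
  by rewrite QE => s0 s1; exact: conv_hull_convex.
have L0 := lip_norm_ge0 f_lip.
have c_ge0 n : 0 <= L * delta n by rewrite mulr_ge0// ltW.
have c_small (eps : R) : 0 < eps ->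
    \forall n \near \oo, L * delta n <= eps * r n.
  (* [L] may vanish, so [eps] is divided by [L + 1]. *)
  move=> e0; have L1 : 0 < L + 1 by rewrite ltr_wpDl.
  have /eqoP/(_ _ (divr_gt0 e0 L1)) := delta_o_r; apply: filterS => n.
  rewrite !gtr0_norm// mulrAC ler_pdivlMr// => /(le_trans _); apply.
  by rewrite mulrC ler_pM2l// lerDl.
have err_ge0 n w : (0 <= err n w)%E by exact: sup_norm_ge0.
have errc_ge0 n w : (0 <= errc n w)%E by exact: sup_norm_ge0.
have errcE n w : (errc n w <= err n w + (L * delta n)%:E)%E.
  exact: sup_norm_convex_estimator (ltW (delta_gt0 n)) (M_sub n) (M_dense n).
split.
- exact: conv_T1_perturb c_small err_ge0 errcE merr merrc.
- exact: conv_T2_perturb c_small err_ge0 errcE merr merrc.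
- exact: conv_T3O_perturb c_small err_ge0 errcE.
- exact: conv_T3o_perturb c_small err_ge0 errc_ge0 errcE.
- exact: conv_T4_perturb c_small err_ge0 errcE merr merrc.
Qed.
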